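(* Let $f\colon\mathcal{E}\to\overline{\mathbb{R}}_{++}$ be any upper semicontinuous, concave function with $R(f)>0$ and $p^*=\sup f\in\mathbb{R}_{++}$ attained at $x^*\in\mathcal{E}$. Fix the stepsizes $\alpha_k=(f^\Gamma(y_k)-d^* )/\|\zeta_k'\|^2$, where $d^*=\inf f^\Gamma$. If $f$ satisfies the Łojasiewicz condition at $x^*$ with exponent $\theta>0$, i.e. for some constants $r>0$, $C>0$ and exponent $\theta\in(0,1)$, $$\mathrm{dist}(0,\partial^P f(x))\ge C\,(f(x^* )-f(x))^\theta\qquad\text{for all }x\in B(x^*,r),$$ then the radial subgradient method has $x_k=y_k/f^\Gamma(y_k)$ satisfying $$T\ge O\!\left(1/\epsilon^{2\theta}\right)\quad\Longrightarrow\quad\min_{k<T}\left\{\frac{p^*-f(x_k)}{f(x_k)}\right\}\le\epsilon,$$ where the constant in $O(\cdot)$ does not depend on $\epsilon$.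
   Context: $\mathcal{E}$ is a finite-dimensional Euclidean space with norm $\|\cdot\|$; $B(x,r)$ is the ball of radius $r$ about $x$; $\overline{\mathbb{R}}_{++}=\mathbb{R}_{++}\cup\{0,+\infty\}$. For $f\colon\mathcal{E}\to\overline{\mathbb{R}}_{++}$: $\mathrm{dom}\,f=\{x: f(x)\in\mathbb{R}_{++}\}$, $\mathrm{epi}\,f=\{(x,u)\in\mathcal{E}\times\mathbb{R}_{++}: f(x)\le u\}$, $\mathrm{hypo}\,f=\{(x,u)\in\mathcal{E}\times\mathbb{R}_{++}: f(x)\ge u\}$; $f$ is upper semicontinuous if $\mathrm{hypo}\,f$ is closed with respect to $\mathcal{E}\times\mathbb{R}_{++}$, and concave if $\mathrm{hypo}\,f$ is convex. With $\Gamma(x,u)=(x,1)/u$, the radial dual is $f^\Gamma(y)=\sup\{v>0: (y,v)\in\Gamma(\mathrm{epi}\,f)\}=\sup\{v>0: v\cdot f(y/v)\le 1\}$, with $\sup\emptyset=0$. Proximal normals of $S\subseteq\mathcal{E}\times\mathbb{R}$ at $(x,u)\in S$: $N^P_S((x,u))=\{(\zeta,\delta): (x,u)\text{ is a nearest point of }S\text{ to }(x,u)+\epsilon(\zeta,\delta)\text{ for some }\epsilon>0\}$. Proximal sub- and supdifferentials: $\partial_P g(y)=\{\zeta:(\zeta,-1)\in N^P_{\mathrm{epi}\,g}((y,g(y)))\}$ and $\partial^P f(x)=\{\zeta:(-\zeta,1)\in N^P_{\mathrm{hypo}\,f}((x,f(x)))\}$; as usual the distance to the empty set is $+\infty$.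 $R(f)=\inf\{\|x'\| : (x,u)\in\mathrm{hypo}\,f,\ 0\ne(\zeta,\delta)\in N^P_{\mathrm{hypo}\,f}((x,u)),\ x'\in\mathcal{E},\ (\zeta,\delta)^T((x',0)-(x,u))=0\}$. Radial subgradient method, run for $T$ steps: given $x_0\in\mathrm{dom}\,f$ and stepsizes $\alpha_k$, set $(y_0,v_0)=\Gamma(x_0,f(x_0))$, i.e. $y_0=x_0/f(x_0)$, and for $k=0,1,\dots,T-1$ set $y_{k+1}=y_k-\alpha_k\zeta_k'$ where $\zeta_k'\in\partial_P f^\Gamma(y_k)$.
   Formalization: The Łojasiewicz condition with exponent θ is assumed at every maximiser x* of f (r, C may depend on the maximiser), not just at one; with several maximisers the claim from one alone is false, and with a unique maximiser the two statements agree. *)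

(* Defs.v *)
From HB Require Import structures.
From mathcomp Require Import all_boot all_order all_algebra.
From mathcomp Require Import all_classical all_reals all_analysis.
Import numFieldNormedType.Exports.

Set Implicit Arguments.
Unset Strict Implicit.
Unset Printing Implicit Defensive.

Import Order.TTheory GRing.Theory Num.Theory.

Local Open Scope classical_set_scope.
Local Open Scope ring_scope.

(* The Euclidean space is 'rV[R]_n.  The library norm on 'rV[R]_n and on
   products is the max norm, so the Euclidean structures are defined here; the
   library topologies on 'rV[R]_n and 'rV[R]_n * R are the Euclidean ones. *)
Section Euclidean.
Context {R : realType} {n : nat}.

Definition dotv (x y : 'rV[R]_n) : R := \sum_(i < n) x 0 i * y 0 i.
Definition norm2 (x : 'rV[R]_n) : R := Num.sqrt (dotv x x).

Definition pdot (p q : 'rV[R]_n * R) : R := dotv p.1 q.1 + p.2 * q.2.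
Definition pnorm (p : 'rV[R]_n * R) : R := Num.sqrt (pdot p p).

End Euclidean.

(* A function with values in R_{++} `|` {0, +oo} is modelled as a function
   into \bar R that is nonnegative everywhere. *)
Section RadialDuality.
Context {R : realType} {n : nat}.
Implicit Types (f g : 'rV[R]_n -> \bar R) (S : set ('rV[R]_n * R)).

Definition dom f : set 'rV[R]_n := [set x | (0 < f x < +oo)%E].
Definition epi f : set ('rV[R]_n * R) :=
  [set p | 0 < p.2 /\ (f p.1 <= p.2%:E)%E].
Definition hypo f : set ('rV[R]_n * R) :=
  [set p | 0 < p.2 /\ (p.2%:E <= f p.1)%E].

Definition usc f : Prop :=
  closed (hypo f : set (subspace [set p : 'rV[R]_n * R | 0 < p.2])).

Definition concave f : Prop :=
  convex_set (hypo f : set (convex_lmodType ('rV[R]_n * R^o)%type)).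

Definition Gamma (p : 'rV[R]_n * R) : 'rV[R]_n * R :=
  (p.2^-1 *: p.1, p.2^-1).

(* The maximum with 0 encodes the convention sup set0 = 0, as
   ereal_sup set0 = -oo. *)
Definition radial_dual f (y : 'rV[R]_n) : \bar R :=
  maxe 0%E (ereal_sup [set v%:E | v in [set v : R |
                        0 < v /\ (Gamma @` epi f) (y, v)]]).

Definition proximal_normal S (p : 'rV[R]_n * R) : set ('rV[R]_n * R) :=
  [set q | S p /\ exists2 e : R, 0 < e &
     forall s, S s -> pnorm (p + e *: (q : 'rV[R]_n * R^o) - p)
                      <= pnorm (p + e *: (q : 'rV[R]_n * R^o) - s)].

(* Both are empty at points where the function is 0 or +oo. *)
Definition proximal_subdiff g (y : 'rV[R]_n) : set 'rV[R]_n :=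
  [set zeta | exists2 u : R, g y = u%:E &
     proximal_normal (epi g) (y, u) (zeta, -1)].
Definition proximal_supdiff f (x : 'rV[R]_n) : set 'rV[R]_n :=
  [set zeta | exists2 u : R, f x = u%:E &
     proximal_normal (hypo f) (x, u) (- zeta, 1)].

Definition dist0 (A : set 'rV[R]_n) : \bar R :=
  ereal_inf [set (norm2 z)%:E | z in A].

Definition Rconst f : \bar R :=
  ereal_inf [set (norm2 x')%:E | x' in [set x' : 'rV[R]_n |
    exists p q : 'rV[R]_n * R,
      [/\ hypo f p, q != 0, proximal_normal (hypo f) p q
        & pdot q ((x', 0) - p) = 0]]].

Definition lojasiewicz f (theta : R) (xstar : 'rV[R]_n) : Prop :=
  exists r C : R, [/\ 0 < r, 0 < C &
    forall x, norm2 (x - xstar) <= r ->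
      (C%:E * poweR (f xstar - f x) theta <= dist0 (proximal_supdiff f x))%E].

(* y and zeta may take arbitrary values beyond the indices T and T - 1. *)
Definition radial_subgradient_method f (x0 : 'rV[R]_n) (T : nat)
    (alpha : nat -> R) (y zeta : nat -> 'rV[R]_n) : Prop :=
  y 0%N = (Gamma (x0, fine (f x0))).1 /\
  forall k, (k < T)%N ->
    proximal_subdiff (radial_dual f) (y k) (zeta k) /\
    y k.+1 = y k - alpha k *: zeta k.

(* If zeta = 0 the quotient is 0 / 0 = 0 in R, and the value of the stepsize is
   immaterial since the step is a multiple of zeta. *)
Definition polyak_stepsize f (y zeta : 'rV[R]_n) : R :=
  (fine (radial_dual f y) - fine (ereal_inf (range (radial_dual f))))
    / norm2 zeta ^+ 2.

Definition primal_iterate f (y : 'rV[R]_n) : 'rV[R]_n :=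
  (fine (radial_dual f y))^-1 *: y.

End RadialDuality.

(* Main.v *)
Require Import Defs.
From HB Require Import structures.
From mathcomp Require Import all_boot all_order all_algebra.
From mathcomp Require Import all_classical all_reals all_analysis.
From mathcomp Require Import ring lra.
Import numFieldNormedType.Exports.
Import Order.TTheory GRing.Theory Num.Theory.
Local Open Scope classical_set_scope.
Local Open Scope ring_scope.

(* The radial dual [g = f^Gamma] is convex, [(x, u) |-> (x, 1) / u] carries
   [hypo f] into its epigraph, and [inf g = 1 / p*].  A subgradient [zeta] of [g]
   at an iterate is a normal to [hypo f] whose hyperplane meets height [0] at
   distance [1 / |zeta|] from the origin, so [|zeta| <= 1 / R(f)]; the same constant
   forces [f 0 > 0], on which the correspondence of hypograph and epigraph relies.

   The Lojasiewicz inequality implies, by Ekeland's argument, the error bound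
   [dist (x, argmax f) <= kappa (p* - f x)^(1 - theta)] near each maximiser, hence
   by compactness on bounded sets; it transfers to
   [dist (y, argmin g) <= kappa' (g y - d* )^(1 - theta)] along the iterates.  The
   Polyak step decreases the squared distance to [argmin g] by at least
   [(R(f) (g y_k - d* ))^2], which together with the error bound allows only
   [O(eps^(-2 theta))] steps with gap above [eps]. *)

(** * Euclidean space and proximal normals *)

Section Euclidean.
Context {R : realType} {n : nat}.
Implicit Types (x y z : 'rV[R]_n) (a b : R).

Lemma dotvC x y : dotv x y = dotv y x.
Proof. by apply: eq_bigr => i _; rewrite mulrC. Qed.

Lemma dotvDl x y z : dotv (x + y) z = dotv x z + dotv y z.
Proof. by rewrite -big_split; apply: eq_bigr => i _; rewrite mxE mulrDl. Qed.

Lemma dotvZl a x y : dotv (a *: x) y = a * dotv x y.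
Proof. by rewrite mulr_sumr; apply: eq_bigr => i _; rewrite mxE mulrA. Qed.

Lemma dotvNl x y : dotv (- x) y = - dotv x y.
Proof. by rewrite -scaleN1r dotvZl mulN1r. Qed.

Lemma dotvDr x y z : dotv x (y + z) = dotv x y + dotv x z.
Proof. by rewrite dotvC dotvDl !(dotvC _ x). Qed.

Lemma dotvZr a x y : dotv x (a *: y) = a * dotv x y.
Proof. by rewrite dotvC dotvZl dotvC. Qed.

Lemma dotvNr x y : dotv x (- y) = - dotv x y.
Proof. by rewrite dotvC dotvNl dotvC. Qed.

Lemma dot0v x : dotv 0 x = 0.
Proof. by rewrite -(scale0r 0) dotvZl mul0r. Qed.

Lemma dotv0 x : dotv x 0 = 0.
Proof. by rewrite dotvC dot0v. Qed.

Definition dotvE := (dotvDl, dotvDr, dotvZl, dotvZr, dotvNl, dotvNr, dot0v, dotv0).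

Lemma dotvv_ge0 x : 0 <= dotv x x.
Proof. by apply: sumr_ge0 => i _; rewrite -expr2 sqr_ge0. Qed.

Lemma dotvv_eq0 x : dotv x x = 0 -> x = 0.
Proof.
move=> /eqP; rewrite psumr_eq0; last by move=> i _; rewrite -expr2 sqr_ge0.
move=> /allP h; apply/rowP => i; rewrite mxE; apply/eqP.
by have := h i (mem_index_enum _); rewrite -expr2 sqrf_eq0.
Qed.

Lemma norm2_ge0 x : 0 <= norm2 x.
Proof. exact: sqrtr_ge0. Qed.

Lemma sqr_norm2 x : norm2 x ^+ 2 = dotv x x.
Proof. by rewrite sqr_sqrtr // dotvv_ge0. Qed.

Lemma norm2_gt0 x : x != 0 -> 0 < norm2 x.
Proof.
move=> x0; rewrite lt_neqAle norm2_ge0 andbT eq_sym; apply: contra x0 => /eqP h.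
by apply/eqP/dotvv_eq0; rewrite -sqr_norm2 h expr0n.
Qed.

Lemma norm2_0 : norm2 (0 : 'rV[R]_n) = 0.
Proof. by rewrite /norm2 dot0v sqrtr0. Qed.

Lemma norm2_le x b : 0 <= b -> dotv x x <= b ^+ 2 -> norm2 x <= b.
Proof.
by move=> b0; rewrite -sqr_norm2 ler_sqr ?nnegrE ?norm2_ge0.
Qed.

Lemma norm2Z a x : norm2 (a *: x) = `|a| * norm2 x.
Proof.
by rewrite /norm2 !dotvE mulrA -expr2 sqrtrM ?sqr_ge0 // sqrtr_sqr.
Qed.

Lemma norm2N x : norm2 (- x) = norm2 x.
Proof. by rewrite -scaleN1r norm2Z normrN1 mul1r. Qed.

Lemma norm2B x y : norm2 (x - y) = norm2 (y - x).
Proof. by rewrite -norm2N opprB. Qed.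

(** Cauchy-Schwarz: expand the squared norm of [norm2 y *: x - norm2 x *: y] and divide by twice the
    product of the norms. *)
Lemma dotv_le x y : dotv x y <= norm2 x * norm2 y.
Proof.
have [->|x0] := eqVneq x 0; first by rewrite dot0v norm2_0 mul0r.
have X := norm2_gt0 _ x0.
have := dotvv_ge0 (norm2 y *: x - norm2 x *: y).
rewrite !dotvE -!sqr_norm2 (dotvC y x).
set p := norm2 x in X *; set q := norm2 y; set d := dotv x y => h.
have [q0|q0] := leP q 0.
  have q00 : q = 0 by apply/eqP; rewrite eq_le q0 norm2_ge0.
  have y0 : y = 0 by apply: dotvv_eq0; rewrite -sqr_norm2 -/q q00 expr0n.
  by rewrite /d y0 dotv0 q00 mulr0.
have pq : 0 < 2 * (p * q) by rewrite !mulr_gt0.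
by rewrite -(ler_pM2l pq); nra.
Qed.

Lemma norm2_triangle x y : norm2 (x + y) <= norm2 x + norm2 y.
Proof.
apply: norm2_le; first by rewrite addr_ge0 ?norm2_ge0.
rewrite !dotvE (dotvC y x) sqrrD !sqr_norm2.
by have := dotv_le x y; lra.
Qed.

Lemma norm2_coord x (i : 'I_n) : `|x 0 i| <= norm2 x.
Proof.
rewrite -sqrtr_sqr ler_wsqrtr // /dotv (bigD1 i) //= expr2 lerDl.
by apply: sumr_ge0 => j _; rewrite -expr2 sqr_ge0.
Qed.

End Euclidean.

(** * Proximal normals and variational inequalities *)

Section ProximalNormal.
Context {R : realType} {n : nat}.
Implicit Types (S : set ('rV[R]_n * R)) (p q s : 'rV[R]_n * R).

(** Serves to drop the quadratic term of an expansion along a segment: a positive [c] fails at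
    [t = c / (2 * (w + c))]. *)
Lemma le0_small_multiples (c w : R) :
  0 <= w -> (forall t, 0 < t <= 1 -> c <= t * w) -> c <= 0.
Proof.
move=> w0 h; rewrite leNgt; apply/negP => c0.
have w1 : 0 < w + c by lra.
pose t := c / (2 * (w + c)).
have t0 : 0 < t by rewrite divr_gt0 // mulr_gt0.
have tE : t * (2 * (w + c)) = c by rewrite divfK // gt_eqF // mulr_gt0.
have /h : 0 < t <= 1 by rewrite t0 ler_pdivrMr ?mulr_gt0 //; lra.
by nra.
Qed.

Lemma pdotvv_ge0 p : 0 <= pdot p p.
Proof. by rewrite /pdot addr_ge0 ?dotvv_ge0 // -expr2 sqr_ge0. Qed.

Lemma pnorm_le p q : (pnorm p <= pnorm q) = (pdot p p <= pdot q q).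
Proof. by rewrite /pnorm ler_sqrt // pdotvv_ge0. Qed.

(** Moving from [p] towards [s] by the fraction [t] changes the squared distance to [p + q] by
    [- 2 * t * pdot q (s - p)] plus a term of order [t ^+ 2]; minimality makes the linear term
    nonnegative. *)
Lemma nearest_le S p q s :
  (forall s', S s' -> pdot q q <= pdot (p + q - s') (p + q - s')) ->
  (forall t, 0 < t <= 1 ->
     S (p.1 + t *: (s.1 - p.1), p.2 + t * (s.2 - p.2))) ->
  pdot q (s - p) <= 0.
Proof.
move=> qP sS; suff : 2 * pdot q (s - p) <= 0 by lra.
apply: (@le0_small_multiples _ (pdot (s - p) (s - p))); first exact: pdotvv_ge0.
move=> t /[dup] t01 /andP[t0 _]; have := qP _ (sS _ t01).
rewrite -[X in _ -> is_true X](ler_pM2l t0) /pdot /= !dotvE.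
by rewrite (dotvC s.1 p.1) (dotvC p.1 q.1) (dotvC s.1 q.1); nra.
Qed.

Lemma proximal_normal_le S p q s : proximal_normal S p q ->
  (forall t, 0 < t <= 1 ->
     S (p.1 + t *: (s.1 - p.1), p.2 + t * (s.2 - p.2))) ->
  pdot q (s - p) <= 0.
Proof.
move=> [_ [e e0 near_p]] sS.
suff : pdot (e *: q.1, e * q.2) (s - p) <= 0.
  by rewrite /pdot /= dotvZl -mulrA -mulrDr pmulr_rle0.
apply: (@nearest_le S) => // s' Ss'; have := near_p _ Ss'.
rewrite pnorm_le; congr (_ <= _).
by rewrite /pdot /= (addrC p.1) (addrC p.2) !addrK.
Qed.

Lemma proximal_normalW S p q : S p ->
  (forall s, S s -> pdot q (s - p) <= 0) -> proximal_normal S p q.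
Proof.
move=> Sp h; split => //; exists 1 => // s Ss; rewrite pnorm_le.
have := h _ Ss; have := pdotvv_ge0 (s - p).
rewrite /pdot /= !scale1r !dotvE (dotvC s.1 p.1) (dotvC p.1 q.1).
by rewrite (dotvC s.1 q.1) /GRing.scale /=; nra.
Qed.

End ProximalNormal.

(** * Projection onto closed convex sets *)

Section Topology.
Context {R : realType} {n : nat}.
Implicit Types (C : set ('rV[R]_n * R)) (p q s P : 'rV[R]_n * R).

Lemma continuous_dotv (T : topologicalType) (f g : T -> 'rV[R]_n) :
  continuous f -> continuous g -> continuous (fun t => dotv (f t) (g t)).
Proof.
move=> cf cg; apply: continuous_big => [|i _].
  by move=> z; apply: (@cvgD _ R^o); [exact: cvg_fst|exact: cvg_snd].
move=> t; apply: cvgM.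
  by apply: (@continuous_comp _ _ _ f (fun x : 'rV[R]_n => x 0 i));
    [exact: cf|exact: coord_continuous].
by apply: (@continuous_comp _ _ _ g (fun x : 'rV[R]_n => x 0 i));
  [exact: cg|exact: coord_continuous].
Qed.

Lemma continuous_norm2 (T : topologicalType) (f : T -> 'rV[R]_n) :
  continuous f -> continuous (fun t => norm2 (f t)).
Proof.
move=> cf t; apply: (@continuous_comp _ _ _ (fun t => dotv (f t) (f t)) Num.sqrt).
  exact: continuous_dotv.
exact: sqrt_continuous.
Qed.

Lemma continuous_pdot (T : topologicalType) (f g : T -> 'rV[R]_n * R) :
  continuous f -> continuous g -> continuous (fun t => pdot (f t) (g t)).
Proof.
move=> cf cg t; apply: (@cvgD _ R^o).
  apply: (@continuous_dotv T (fun t => (f t).1) (fun t => (g t).1)) => {}t.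
    by apply: cvg_comp; [exact: cf|exact: cvg_fst].
  by apply: cvg_comp; [exact: cg|exact: cvg_fst].
apply: cvgM; first by apply: cvg_comp; [exact: cf|exact: cvg_snd].
by apply: cvg_comp; [exact: cg|exact: cvg_snd].
Qed.

Lemma closed_le_continuous (T : topologicalType) (f : T -> R) (b : R) :
  continuous f -> closed [set t | f t <= b].
Proof.
move=> cf; apply: (@preimage_closed _ _ f [set x | x <= b]) => [t _|].
  exact: cf.
exact: closed_le.
Qed.

Lemma bounded_closed_compact_pair C (M : R) : closed C ->
  (forall p, C p -> norm2 p.1 <= M /\ `|p.2| <= M) -> compact C.
Proof.
move=> cC bC.
apply: (@subclosed_compact _ _
  ([set x : 'rV[R]_n | forall i, `[- M, M]%classic (x ord0 i)] `*`
   `[- M, M]%classic)) => //.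
  apply: compact_setX; last exact: segment_compact.
  by apply: (@rV_compact _ _ (fun=> `[- M, M]%classic)) => i; exact: segment_compact.
move=> p /bC [p1 p2]; split => [i|] /=; rewrite in_itv /= -ler_norml //.
exact: le_trans (norm2_coord _ _) p1.
Qed.

Lemma nearest_point C P : closed C -> C !=set0 ->
  exists2 p, C p & forall s, C s -> pdot (P - p) (P - p) <= pdot (P - s) (P - s).
Proof.
move=> cC [a Ca]; pose d p := pdot (P - p) (P - p).
have cd : continuous d.
  by apply: continuous_pdot => t; apply: cvgB; (exact: cvg_cst || exact: cvg_id).
pose K := C `&` [set p | d p <= d a].
have cK : compact K.
  pose M := norm2 P.1 + `|P.2| + Num.sqrt (d a).
  apply: (@bounded_closed_compact_pair _ M).
    by apply: closedI => //; exact: closed_le_continuous.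
  move=> p [_ /=]; rewrite /d /pdot /= -expr2 => dp.
  have d0 : 0 <= dotv (P.1 - p.1) (P.1 - p.1) by exact: dotvv_ge0.
  have sq0 : 0 <= (P.2 - p.2) ^+ 2 by exact: sqr_ge0.
  rewrite /M; split.
    have : norm2 (p.1 - P.1) <= Num.sqrt (d a).
      by rewrite norm2B; apply: ler_wsqrtr; rewrite /d /pdot -expr2; lra.
    have := norm2_triangle (p.1 - P.1) P.1; rewrite subrK.
    by have := normr_ge0 P.2; lra.
  have : `|p.2 - P.2| <= Num.sqrt (d a).
    by rewrite distrC -sqrtr_sqr; apply: ler_wsqrtr; rewrite /d /pdot -expr2; lra.
  have := ler_normD (p.2 - P.2) P.2; rewrite subrK.
  by have := norm2_ge0 P.1; lra.
have [||p] := @compact_EVT_min _ R d K _ cK; first by exists a; split => //=.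
  exact: continuous_subspaceT.
rewrite inE => -[Cp dpa] h; exists p => // s Cs.
have [dsa|dsa] := leP (d s) (d a); last exact: le_trans (ltW dsa).
by apply: h; rewrite inE.
Qed.

(** Convexity, put on plain pairs in the form that [nearest_le] asks for. *)
Definition segment_closed C := forall p s t, C p -> C s -> 0 <= t <= 1 ->
  C (p.1 + t *: (s.1 - p.1), p.2 + t * (s.2 - p.2)).

Lemma continuous_pair (T U V : topologicalType) (f : T -> U) (g : T -> V) :
  continuous f -> continuous g -> continuous (fun t => (f t, g t)).
Proof. by move=> cf cg t A nA; exact: (cvg_pair (cf t) (cg t)). Qed.

Lemma continuous_segment t s :
  continuous (fun p => (p.1 + t *: (s.1 - p.1), p.2 + t * (s.2 - p.2))).
Proof.
apply: continuous_pair => p.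
  apply: cvgD; first exact: cvg_fst.
  by apply: cvgZr; apply: cvgB; [exact: cvg_cst|exact: cvg_fst].
apply: (@cvgD _ R^o); first exact: cvg_snd.
by apply: cvgMl_tmp; apply: (@cvgB _ R^o); [exact: cvg_cst|exact: cvg_snd].
Qed.

Lemma closure_preimage (T : topologicalType) (A B : set T) (g : T -> T) :
  continuous g -> (forall t, A t -> B (g t)) ->
  forall t, closure A t -> closure B (g t).
Proof.
move=> cg AB t At.
have cl : closed (g @^-1` closure B).
  by apply: preimage_closed; [move=> u _; exact: cg|exact: closed_closure].
have : closure A `<=` g @^-1` closure B.
  rewrite [X in _ `<=` X](closure_id _).1 //; apply: closureS => u Au.
  by apply: subset_closure; exact: AB.
by apply.
Qed.

(** One endpoint passes to the closure at a time, by continuity in that endpoint; replacing [t] by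
    [1 - t] swaps the endpoints. *)
Lemma segment_closed_closure C : segment_closed C -> segment_closed (closure C).
Proof.
move=> sC p s t Cp Cs t01.
have step a : C a -> closure C (p.1 + t *: (a.1 - p.1), p.2 + t * (a.2 - p.2)).
  move=> Ca.
  apply: (@closure_preimage _ C C
    (fun p => (p.1 + t *: (a.1 - p.1), p.2 + t * (a.2 - p.2)))) => //.
    exact: continuous_segment.
  by move=> q Cq; exact: sC.
have swap a b : (a.1 + t *: (b.1 - a.1), a.2 + t * (b.2 - a.2)) =
    (b.1 + (1 - t) *: (a.1 - b.1), b.2 + (1 - t) * (a.2 - b.2)) :> 'rV[R]_n * R.
  congr (_, _); last by ring.
  by apply/rowP => i; rewrite !mxE; ring.
rewrite swap [closure C](closure_id _).1; last exact: closed_closure.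
apply: (@closure_preimage _ C (closure C)
  (fun s => (s.1 + (1 - t) *: (p.1 - s.1), s.2 + (1 - t) * (p.2 - s.2)))) => //.
  exact: continuous_segment.
by move=> a Ca; rewrite -swap; exact: step.
Qed.

Lemma projection C P : closed C -> C !=set0 -> segment_closed C ->
  exists2 p, C p & forall s, C s -> pdot (P - p) (s - p) <= 0.
Proof.
move=> cC C0 sC; have [p Cp h] := nearest_point C P cC C0.
exists p => // s Cs; apply: (@nearest_le _ _ C) => [s' Cs'|t /andP[t0 t1]].
  by rewrite subrKC; exact: h.
by apply: sC => //; rewrite ltW.
Qed.

End Topology.

(** * Hypographs *)

Section Hypograph.
Context {R : realType} {n : nat}.
Context {f : 'rV[R]_n -> \bar R}.
Implicit Types (x z : 'rV[R]_n) (p q s : 'rV[R]_n * R).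

Lemma hypo_gt0 p : hypo f p -> 0 < p.2.
Proof. by case. Qed.

Lemma hypo_down x (u v : R) : hypo f (x, u) -> 0 < v -> v <= u -> hypo f (x, v).
Proof. by move=> [_ /= h] v0 vu; split => //=; rewrite (le_trans _ h) // lee_fin. Qed.

(** Upper semicontinuity closes the hypograph relative to positive heights only, and limit points at
    height 0 may lie outside; hence the condition on [p.2]. *)
Lemma hypo_closure p : usc f -> closure (hypo f) p -> 0 < p.2 -> hypo f p.
Proof.
move=> /closed_subspaceP[V cV VE] clp p0.
suff : (V `&` [set p : 'rV[R]_n * R | 0 < p.2]) p by rewrite VE => -[].
split => //; move/closure_id: cV => ->; apply: closureS clp => s Hs.
suff : (V `&` [set p : 'rV[R]_n * R | 0 < p.2]) s by case.
by rewrite VE; split => //; exact: hypo_gt0.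
Qed.

Lemma hypo_segment_closed : concave f -> segment_closed (hypo f).
Proof.
move=> cf p s t Hp Hs /andP[t0 t1].
pose i := Itv01 t0 t1.
have ps (a : 'rV[R]_n * R) : hypo f a ->
    a \in (hypo f : set (convex_lmodType ('rV[R]_n * R^o)%type)).
  by rewrite inE.
have := cf s p i (ps _ Hs) (ps _ Hp); rewrite inE.
rewrite /conv /= /GRing.add /GRing.scale /= => h.
have -> : (p.1 + t *: (s.1 - p.1), p.2 + t * (s.2 - p.2)) =
   (t *: s.1 + (1 - t) *: p.1, t * s.2 + (1 - t) * p.2) :> 'rV[R]_n * R.
  congr (_, _); last by ring.
  by apply/rowP => j; rewrite !mxE; ring.
exact: h.
Qed.

Context {pstar : R}.
Hypothesis f_ge0 : forall x, (0 <= f x)%E.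
Hypothesis f_le : forall x, (f x <= pstar%:E)%E.

Lemma fineK_f x : f x = (fine (f x))%:E.
Proof.
rewrite fineK // fin_real // (lt_le_trans _ (f_ge0 x)) ?ltNye //=.
by rewrite (le_lt_trans (f_le x)) // ltry.
Qed.

Lemma hypoE x (u : R) : hypo f (x, u) <-> 0 < u /\ u <= fine (f x).
Proof. by rewrite /hypo /= {1}fineK_f lee_fin. Qed.

Lemma hypo_le p : hypo f p -> p.2 <= pstar.
Proof. by move=> [_ h]; rewrite -lee_fin (le_trans h). Qed.

Lemma fine_f_le x : fine (f x) <= pstar.
Proof. by rewrite -lee_fin -fineK_f. Qed.

End Hypograph.

(** * Positivity of the function at the origin *)

Section Origin.
Context {R : realType} {n : nat}.
Context {f : 'rV[R]_n -> \bar R}.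
Context {pstar : R}.
Implicit Types (x z : 'rV[R]_n) (p q : 'rV[R]_n * R).

Lemma Rconst_le p q x : hypo f p -> q != 0 -> proximal_normal (hypo f) p q ->
  pdot q ((x, 0) - p) = 0 -> (Rconst f <= (norm2 x)%:E)%E.
Proof.
by move=> Hp q0 pn pd; apply: ereal_inf_lbound; exists x => //; exists p, q.
Qed.

Lemma lipschitz_continuous (g : R -> R) :
  (forall s t, `|g s - g t| <= `|s - t|) -> continuous g.
Proof.
move=> h s; apply/cvgrPdist_lt => e e0; near=> t.
by apply: le_lt_trans (h _ _) _; near: t; apply: cvgr_dist_lt.
Unshelve. all: by end_near. Qed.

Hypothesis f_le : forall x, (f x <= pstar%:E)%E.
Hypothesis f_usc : usc f.
Hypothesis f_concave : concave f.
Variable xstar : 'rV[R]_n.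
Hypothesis f_xstar : f xstar = pstar%:E.
Hypothesis pstar_gt0 : 0 < pstar.

Lemma hypo_xstar : hypo f (xstar, pstar).
Proof. by split => //=; rewrite f_xstar. Qed.

Lemma closure_hypo_height p : closure (hypo f) p -> 0 <= p.2 <= pstar.
Proof.
move=> cp; apply/andP; split.
  have : closed [set p : 'rV[R]_n * R | - p.2 <= 0].
    by apply: closed_le_continuous => t; apply: (@cvgN _ R^o); exact: cvg_snd.
  move/closure_id => E.
  suff : [set p : 'rV[R]_n * R | - p.2 <= 0] p by rewrite /= oppr_le0.
  rewrite E; apply: closureS cp => u /hypo_gt0 u0 /=.
  by rewrite oppr_le0 ltW.
have : closed [set p : 'rV[R]_n * R | p.2 <= pstar].
  by apply: closed_le_continuous => t; exact: cvg_snd.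
move/closure_id => E.
suff : [set p : 'rV[R]_n * R | p.2 <= pstar] p by [].
by rewrite E; apply: closureS cp => u Hu; exact: (hypo_le f_le _ Hu).
Qed.

Lemma hypo_projection P : exists2 p, closure (hypo f) p &
  forall s, closure (hypo f) s -> pdot (P - p) (s - p) <= 0.
Proof.
apply: projection; first exact: closed_closure.
  by exists (xstar, pstar); apply: subset_closure; exact: hypo_xstar.
exact/segment_closed_closure/hypo_segment_closed.
Qed.

Lemma projection_normal P p : closure (hypo f) p -> 0 < p.2 ->
  (forall s, closure (hypo f) s -> pdot (P - p) (s - p) <= 0) ->
  hypo f p /\ proximal_normal (hypo f) p (P - p).
Proof.
move=> cp p0 h; have Hp := hypo_closure _ f_usc cp p0; split => //.
by apply: proximal_normalW => // s Hs; apply: h; exact: subset_closure.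
Qed.

(* If [f 0 = 0], project the points [(0, s)], [s > 0], onto the closure of the
   hypograph; [c s] is the offset of the supporting hyperplane so obtained,
   positive for large [s].  A zero of [c] is a supporting hyperplane through the
   origin, and otherwise the trace at height [0] of the hyperplane tends to the
   origin with [s]. *)
Lemma hypo_zero : (0 < Rconst f)%E -> exists2 e, 0 < e & hypo f (0, e).
Proof.
move=> R0; apply: contrapT => no0.
have f0 (s : R) : 0 < s -> ~ closure (hypo f) (0, s).
  by move=> s0 /(hypo_closure _ f_usc) h; apply: no0; exists s => //; exact: h.
pose pr (s : R) : 'rV[R]_n * R := projT1 (cid2 (hypo_projection (0, s))).
have prc s : closure (hypo f) (pr s) by rewrite /pr; case: cid2.
have prn s t : closure (hypo f) t -> pdot ((0, s) - pr s) (t - pr s) <= 0.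
  by rewrite /pr; case: cid2 => /= p _ h /h.
pose X (s : R) : 'rV[R]_n := (pr s).1; pose h (s : R) : R := (pr s).2.
pose N (s : R) : R := norm2 (X s).
(* Adding the variational inequalities at [s] and [t] gives firm nonexpansiveness; hence [h] and [N]
   are 1-Lipschitz and [c] is continuous. *)
have firm s t : dotv (X s - X t) (X s - X t) + (h s - h t) ^+ 2 <=
    (s - t) * (h s - h t).
  have := prn s _ (prc t); have := prn t _ (prc s).
  rewrite /pdot /= -/(X s) -/(X t) -/(h s) -/(h t) !dotvE (dotvC (X t)).
  by lra.
have hl s t : `|h s - h t| <= `|s - t|.
  have := firm s t; have := dotvv_ge0 (X s - X t).
  move=> d0 d1; have {}d1 : (h s - h t) ^+ 2 <= (s - t) * (h s - h t) by lra.
  have := ler_norm ((s - t) * (h s - h t)); rewrite normrM.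
  have := real_normK (num_real (h s - h t)).
  have := normr_ge0 (h s - h t); have := normr_ge0 (s - t).
  by nra.
have Nl s t : `|N s - N t| <= `|s - t|.
  have D : norm2 (X s - X t) <= `|s - t|.
    apply: norm2_le => //; rewrite real_normK ?num_real //.
    have := firm s t; have := sqr_ge0 ((s - t) / 2 - (h s - h t)).
    by have := sqr_ge0 (s - t); nra.
  apply: le_trans D; rewrite ler_norml.
  have := norm2_triangle (X s - X t) (X t); have := norm2_triangle (X t - X s) (X s).
  by rewrite !subrK (norm2B (X t)) -/(N s) -/(N t) => *; apply/andP; split; lra.
pose c (s : R) : R := - N s ^+ 2 + (s - h s) * h s.
have cE s : pdot ((0, s) - pr s) (pr s) = c s.
  by rewrite /pdot /= !dotvE -sqr_norm2 /c -/(N s) -/(h s); ring.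
have cc : continuous c.
  have ch := lipschitz_continuous _ hl; have cN := lipschitz_continuous _ Nl.
  move=> s; apply: (@cvgD _ R^o).
    by apply: (@cvgN _ R^o); apply: (@cvgM _ _ _ _ N N); exact: cN.
  by apply: cvgM; [apply: (@cvgB _ R^o); [exact: cvg_id|exact: ch]|exact: ch].
have qA s : pdot ((0, s) - pr s) (xstar, pstar) <= c s.
  have /(prn s) := subset_closure hypo_xstar.
  by rewrite -cE /pdot /= !dotvE; lra.
have qAE s : pdot ((0, s) - pr s) (xstar, pstar) =
    - dotv (X s) xstar + (s - h s) * pstar.
  by rewrite /pdot /= !dotvE; ring.
have hb s : 0 <= h s <= pstar by exact: closure_hypo_height.
(* At height 0, [c s = - N s ^+ 2]; were this 0, the supporting hyperplane would be the plane at
   height 0, with [(xstar, pstar)] strictly on the wrong side. *)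
have not00 s : 0 < s -> h s = 0 -> c s < 0.
  move=> s0 hs0; rewrite lt_neqAle; apply/andP; split; last first.
    by rewrite /c hs0 mulr0 addr0 oppr_le0 sqr_ge0.
  apply/eqP => cs0; have := qA s; rewrite qAE cs0 hs0.
  have -> : X s = 0.
    apply: dotvv_eq0; rewrite -sqr_norm2 -/(N s).
    by move: cs0; rewrite /c hs0 mulr0 addr0 => /eqP; rewrite oppr_eq0 => /eqP.
  rewrite dot0v; have : 0 < s * pstar by rewrite mulr_gt0.
  by lra.
have q0 s : 0 < s -> (0, s) - pr s != 0.
  by move=> s0; rewrite subr_eq0; apply/eqP => E; apply: (f0 s s0); rewrite E.
have cpos s : 0 < s -> 0 < c s.
  move=> s0; rewrite ltNge; apply/negP => cs.
  pose a := norm2 xstar.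
  have a0 : 0 <= a by exact: norm2_ge0.
  (* [(t - pstar) * pstar] exceeds [a ^+ 2], a bound for [dotv (X t) xstar], so testing the normal
     at [(xstar, pstar)] yields [c t >= 0]. *)
  pose t := s + pstar + (a ^+ 2 + 1) / pstar.
  have st : s <= t.
    by rewrite /t -addrA lerDl addr_ge0 ?divr_ge0 ?addr_ge0 ?sqr_ge0 // ltW.
  have tE : (t - s - pstar) * pstar = a ^+ 2 + 1.
    by rewrite /t (_ : _ - s - pstar = (a ^+ 2 + 1) / pstar) ?divfK ?gt_eqF //; lra.
  have ct : 0 <= c t.
    apply: le_trans (qA t); rewrite qAE.
    have Na : N t <= a.
      apply: norm2_le => //; rewrite sqr_norm2.
      have := prn t _ (subset_closure hypo_xstar).
      rewrite /pdot /= -/(X t) -/(h t) !dotvE.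
      have := dotvv_ge0 (X t - xstar); rewrite !dotvE (dotvC xstar).
      have /andP[h0 h1] := hb t; have tp : pstar <= t by nra.
      by nra.
    have := dotv_le (X t) xstar; rewrite -/(N t) -/a.
    have /andP[h0 h1] := hb t; have := norm2_ge0 (X t); rewrite -/(N t).
    by nra.
  have [|u] := @IVT R c s t 0 st (continuous_subspaceT cc).
    by rewrite ge_min cs le_max ct orbT.
  rewrite in_itv /= => /andP[su _] cu0.
  have u0 : 0 < u by exact: lt_le_trans su.
  have hu : 0 < h u.
    rewrite lt_neqAle eq_sym; have /andP[-> _] := hb u; rewrite andbT.
    by apply/eqP => /(not00 _ u0); rewrite cu0 ltxx.
  have [Hp pn] := projection_normal _ _ (prc u) hu (prn u).
  suff : (Rconst f <= (norm2 (0 : 'rV[R]_n))%:E)%E by rewrite norm2_0 leNgt R0.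
  apply: (Rconst_le _ _ _ Hp (q0 _ u0) pn).
  by have := cE u; rewrite cu0 /pdot /= !dotvE; lra.
(* [Rconst f] may be infinite; a finite positive lower bound replaces it. *)
have [rho rho0 rhoR] : exists2 rho : R, 0 < rho & (rho%:E <= Rconst f)%E.
  move: R0; case: (Rconst f) => [r| |] //; first by rewrite lte_fin; exists r.
  by move=> _; exists 1 => //; exact: leey.
pose a := norm2 xstar.
have a0 : 0 <= a by exact: norm2_ge0.
(* The bounds below end in [rho * pstar <= s * (rho + a)]; for this [s] the right side is half of
   the left. *)
pose s := rho * pstar / (2 * (rho + a)).
have ra : 0 < rho + a by lra.
have rp : 0 < rho * pstar by exact: mulr_gt0.
have s0 : 0 < s by rewrite divr_gt0 // mulr_gt0.
have sE : s * (2 * (rho + a)) = rho * pstar.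
  by rewrite divfK // gt_eqF // mulr_gt0.
have hs : 0 < h s.
  rewrite lt_neqAle eq_sym; have /andP[-> _] := hb s; rewrite andbT.
  by apply/eqP => /(not00 _ s0); have := cpos _ s0; lra.
have cs := cpos _ s0.
have cds : c s <= (s - h s) * s.
  by rewrite /c; have := sqr_ge0 (N s); have := sqr_ge0 (s - h s); nra.
have dn : (s - h s) * (pstar - s) <= N s * a.
  have := qA s; rewrite qAE; have := dotv_le (X s) xstar.
  by rewrite -/(N s) -/a; nra.
have sp : s < pstar by nra.
have ds : 0 < s - h s by nra.
have N0 : 0 < N s.
  rewrite lt_neqAle norm2_ge0 andbT eq_sym; apply/eqP => N0.
  by move: dn; rewrite N0 mul0r; nra.
have [Hp pn] := projection_normal _ _ (prc s) hs (prn s).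
(* The witness is the foot of the perpendicular from the origin to the trace of the hyperplane at
   height 0; its norm is [c s / N s]. *)
have : (Rconst f <= (norm2 (- (c s / N s ^+ 2) *: X s))%:E)%E.
  apply: (Rconst_le _ _ _ Hp (q0 _ s0) pn).
  have := cE s; rewrite /pdot /= -/(X s) -/(h s) !dotvE.
  have -> : dotv (X s) (X s) = N s ^+ 2 by rewrite sqr_norm2.
  have : c s / N s ^+ 2 * N s ^+ 2 = c s by rewrite divfK // gt_eqF // exprn_gt0.
  by lra.
move=> /(le_trans rhoR); rewrite lee_fin norm2Z normrN -/(N s).
rewrite gtr0_norm ?divr_gt0 ?exprn_gt0 // => h1.
have h2 : rho * N s <= c s.
  have -> : c s = c s / N s ^+ 2 * N s * N s by field; rewrite gt_eqF.
  by rewrite ler_pM2r.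
have h3 : rho * N s * (pstar - s) <= s * (N s * a) by nra.
have h4 : rho * (pstar - s) <= s * a by rewrite -(ler_pM2l N0); lra.
by clear - h4 sE rp; lra.
Qed.

End Origin.

(** * The radial dual *)

Section RadialDual.
Context {R : realType} {n : nat} {f : 'rV[R]_n -> \bar R} {pstar e : R}.
Implicit Types (x y : 'rV[R]_n) (u v w : R).

Hypothesis f_le : forall x, (f x <= pstar%:E)%E.
Hypothesis f_usc : usc f.
Hypothesis f_concave : concave f.
Hypothesis pstar_gt0 : 0 < pstar.
Hypothesis e_gt0 : 0 < e.
Hypothesis f_zero : hypo f (0, e).

Local Notation g := (radial_dual f).

Lemma radial_dual_ub y w : 0 < w -> (f (w^-1 *: y) <= (w^-1)%:E)%E ->
  (w%:E <= g y)%E.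
Proof.
move=> w0 fw; rewrite /radial_dual le_max; apply/orP; right.
apply: ereal_sup_ubound; exists w => //; split => //.
exists (w^-1 *: y, w^-1); first by split => //=; rewrite invr_gt0.
by rewrite /Gamma /= invrK scalerA mulfV ?gt_eqF // scale1r.
Qed.

(** Mixing [(0, e)] with [(v^-1 *: y, v^-1)] at weight [v / w] gives a hypograph point over
    [w^-1 *: y] of height above [w^-1], because [e > 0]; so no [w > v] enters the supremum. *)
Lemma radial_dual_le y v : 0 < v -> hypo f (v^-1 *: y, v^-1) -> (g y <= v%:E)%E.
Proof.
move=> v0 Hv; rewrite /radial_dual ge_max lee_fin (ltW v0) /=.
apply: ub_ereal_sup => _ [w [w0 [[x u] [/= u0 fx]]] /= [yE wE] <-].
rewrite lee_fin leNgt -wE; apply/negP => vw; move: Hv; rewrite -yE => Hv.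
pose t := u * v.
have t1 : t < 1 by rewrite /t -(@mulfV _ u) ?gt_eqF // ltr_pM2l.
have t01 : 0 <= t <= 1 by rewrite (ltW t1) andbT mulr_ge0 // ltW.
have := hypo_segment_closed f_concave _ _ _ f_zero Hv t01.
move=> [_] /=; rewrite subr0 add0r scalerA scalerA.
have -> : t * (v^-1 * u^-1) = 1 by rewrite /t; field; rewrite !gt_eqF.
rewrite scale1r => /le_trans /(_ fx); rewrite lee_fin leNgt => /negP; apply.
have -> : e + t * (v^-1 - e) = u + (1 - t) * e by rewrite /t; field; rewrite gt_eqF.
by rewrite ltrDl mulr_gt0 // subr_gt0.
Qed.

Lemma radial_dual_ge y : ((pstar^-1)%:E <= g y)%E.
Proof. by apply: radial_dual_ub; rewrite ?invr_gt0 ?invrK. Qed.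

(** For [u < v^-1] the value [u^-1 > v] cannot enter the supremum, so [(u *: y, u)] lies in the
    hypograph; upper semicontinuity covers the limit [u = v^-1]. *)
Lemma hypo_radial_dual y v : 0 < v -> g y = v%:E -> hypo f (v^-1 *: y, v^-1).
Proof.
move=> v0 gE; apply: hypo_closure => //=; last by rewrite invr_gt0.
have Hu u : 0 < u < v^-1 -> hypo f (u *: y, u).
  move=> /andP[u0 uv]; split => //=; rewrite leNgt; apply/negP => fu.
  have : ((u^-1)%:E <= g y)%E.
    by apply: radial_dual_ub; rewrite ?invr_gt0 ?invrK //; exact: ltW.
  rewrite gE lee_fin => uv'; move: uv; rewrite ltNge => /negP; apply.
  by rewrite -[leRHS]invrK lef_pV2 ?posrE ?invr_gt0.
have cg : continuous (fun u : R => (u *: y, u)).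
  apply: continuous_pair => u; last exact: cvg_id.
  by apply: cvgZl; exact: cvg_id.
move=> B nB.
have : \forall u \near (v^-1)^'-, B (u *: y, u).
  rewrite near_withinE; have nB' : nbhs v^-1 (fun u => B (u *: y, u)) := cg _ B nB.
  by apply: filterS nB' => u Bu _; exact: Bu.
move=> nB'.
have [u [Bu /Hu]] : exists u, B (u *: y, u) /\ 0 < u < v^-1.
  near (v^-1)^'- => u; exists u; split; first by near: u.
  by apply/andP; split; near: u;
    [apply: nbhs_left_gt; rewrite invr_gt0|exact: nbhs_left_lt].
by exists (u *: y, u).
Unshelve. all: by end_near. Qed.

Lemma inf_radial_dual xstar : f xstar = pstar%:E ->
  ereal_inf (range g) = (pstar^-1)%:E.
Proof.
move=> fx; apply/eqP; rewrite eq_le; apply/andP; split.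
  apply: (@le_trans _ _ (g (pstar^-1 *: xstar))).
    by apply: ereal_inf_lbound; exists (pstar^-1 *: xstar).
  apply: radial_dual_le; first by rewrite invr_gt0.
  rewrite invrK scalerA mulfV ?gt_eqF // scale1r.
  by split => //=; rewrite fx.
by apply: le_ereal_inf_tmp => _ [y _ <-]; exact: radial_dual_ge.
Qed.

(** [Gamma] is projective and maps segments to segments: the parameter [t] on the dual side becomes
    [a = t * v2 / v] on the hypograph. This yields the convexity of the dual. *)
Lemma hypo_perspective_segment y1 y2 v1 v2 t : 0 < v1 -> 0 < v2 ->
  hypo f (v1^-1 *: y1, v1^-1) -> hypo f (v2^-1 *: y2, v2^-1) -> 0 <= t <= 1 ->
  let v := v1 + t * (v2 - v1) in
  0 < v /\ hypo f (v^-1 *: (y1 + t *: (y2 - y1)), v^-1).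
Proof.
move=> v10 v20 H1 H2 /andP[t0 t1] v.
have v0 : 0 < v by rewrite /v; nra.
have vN0 : v != 0 by rewrite gt_eqF.
split=> //; pose a := t * v2 / v.
have a01 : 0 <= a <= 1.
  by rewrite divr_ge0 ?mulr_ge0 ?(ltW v20) ?(ltW v0) //= ler_pdivrMr // /v; nra.
have := hypo_segment_closed f_concave _ _ _ H1 H2 a01 => /=.
have v1E : v - t * v2 = (1 - t) * v1 by rewrite /v; ring.
congr (hypo f (_, _)); last first.
  apply: (mulfI vN0); rewrite mulfV // /a.
  have -> : v * (v1^-1 + t * v2 / v * (v2^-1 - v1^-1)) = (v - t * v2) / v1 + t.
    by field; rewrite !gt_eqF.
  by rewrite v1E mulfK ?gt_eqF // subrK.
apply/rowP => i; rewrite !mxE /a; move: (y1 0 i) (y2 0 i) => c1 c2.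
apply: (mulfI vN0); rewrite mulVKf //.
have -> : v * (v1^-1 * c1 + t * v2 / v * (v2^-1 * c2 - v1^-1 * c1)) =
    (v - t * v2) / v1 * c1 + t * c2 by field; rewrite !gt_eqF.
by rewrite v1E mulfK ?gt_eqF //; ring.
Qed.

(** The segment from [(y, v)] to a point that [Gamma] sends into the hypograph stays in the epigraph
    of the dual, so the local proximal condition becomes a global inequality. *)
Lemma subgradient_le y zeta v : g y = v%:E -> proximal_subdiff g y zeta ->
  forall y' v', 0 < v' -> hypo f (v'^-1 *: y', v'^-1) ->
  dotv zeta (y' - y) <= v' - v.
Proof.
move=> gE [v1]; rewrite gE => -[<-] pn y' v' v'0 H'.
have v0 : 0 < v.
  by rewrite -lte_fin -gE (lt_le_trans _ (radial_dual_ge y)) // lte_fin invr_gt0.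
have : pdot (zeta, -1) ((y', v') - (y, v)) <= 0.
  apply: (proximal_normal_le _ _ _ _ pn) => t /andP[t0 t1] /=.
  have t01 : 0 <= t <= 1 by rewrite (ltW t0).
  have [w0 Hw] := hypo_perspective_segment _ _ _ _ _ v0 v'0
    (hypo_radial_dual _ _ v0 gE) H' t01.
  by split => //=; exact: radial_dual_le.
by rewrite /pdot /=; lra.
Qed.

(** Multiplying the subgradient inequality at [u^-1 *: x] by [u] shows that
    [(zeta, v - dotv zeta y)] is normal to the hypograph at [(v^-1 *: y, v^-1)]. Its hyperplane
    meets height 0 in [dotv zeta x = 1], whose distance from the origin is the bound. *)
Lemma subgradient_bound y zeta v : g y = v%:E -> proximal_subdiff g y zeta ->
  zeta != 0 -> (Rconst f <= ((norm2 zeta)^-1)%:E)%E.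
Proof.
move=> gE sd z0.
have v0 : 0 < v.
  by rewrite -lte_fin -gE (lt_le_trans _ (radial_dual_ge y)) // lte_fin invr_gt0.
have Hp := hypo_radial_dual _ _ v0 gE.
have nz := norm2_gt0 _ z0.
have -> : (norm2 zeta)^-1 = norm2 ((norm2 zeta ^+ 2)^-1 *: zeta).
  rewrite norm2Z gtr0_norm ?invr_gt0 ?exprn_gt0 //.
  by field; rewrite gt_eqF.
apply: (@Rconst_le _ _ _ _ (zeta, v - dotv zeta y) _ Hp).
- by apply: contra z0 => /eqP[-> _].
- apply: proximal_normalW => // -[x u] Hxu.
  have u0 : 0 < u := hypo_gt0 _ Hxu.
  have := subgradient_le _ _ _ gE sd (u^-1 *: x) u^-1.
  rewrite invrK scalerA mulfV ?gt_eqF // scale1r invr_gt0 => /(_ u0 Hxu).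
  rewrite /pdot /= !dotvE -(ler_pM2l u0).
  have -> : u * (u^-1 - v) = 1 - u * v by field; rewrite gt_eqF.
  have -> : u * (u^-1 * dotv zeta x - dotv zeta y) = dotv zeta x - u * dotv zeta y.
    by field; rewrite gt_eqF.
  have : v^-1 * v = 1 by rewrite mulVf // gt_eqF.
  by move: (v^-1) => w wE h; nra.
rewrite /pdot /= !dotvE -!sqr_norm2.
have -> : (norm2 zeta ^+ 2)^-1 * norm2 zeta ^+ 2 = 1.
  by rewrite mulVf // gt_eqF // exprn_gt0.
by field; rewrite gt_eqF.
Qed.

End RadialDual.

(** * Error bound from the Lojasiewicz inequality *)

Section Powers.
Context {R : realType}.
Implicit Types (a b s t w : R).

(** Bernoulli's inequality for a negative exponent, from [expR x >= 1 + x] and [ln w <= w - 1]. *)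
Lemma powRN_ge w s : 0 < w -> 0 <= s -> 1 + s * (1 - w) <= w `^ (- s).
Proof.
move=> w0 s0; rewrite /powR gt_eqF //.
apply: le_trans (expR_ge1Dx _); rewrite lerD2l mulNr -mulrN ler_wpM2l //.
have : ln (1 + (w - 1)) <= w - 1 by apply: le_ln1Dx; lra.
by rewrite addrC subrK; lra.
Qed.

(** The derivative at the larger endpoint bounds the increment of a concave power. After scaling by
    [a], [powRN_ge] bounds the power of [w] by [1 / (1 + d)], and [d <= 1] costs the factor 1/2. *)
Lemma powRB_ge a b s : 0 < s <= 1 -> 0 <= b -> b < a ->
  s / 2 * a `^ (s - 1) * (a - b) <= a `^ s - b `^ s.
Proof.
move=> /andP[s0 s1] b0 ba; have a0 : 0 < a by lra.
have aE : a `^ (s - 1) * a = a `^ s by rewrite mulrC mulr_powRB1 // ltW.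
have p0 : 0 < a `^ s by exact: powR_gt0.
pose w := b / a.
have bE : b = w * a by rewrite /w divfK // gt_eqF.
have w0 : 0 <= w by rewrite divr_ge0 // ltW.
have w1 : w < 1 by rewrite ltr_pdivrMr // mul1r.
have -> : s / 2 * a `^ (s - 1) * (a - b) = s / 2 * (1 - w) * a `^ s.
  by rewrite -aE {1}bE; ring.
rewrite bE powRM ?(ltW a0) //.
rewrite -[X in _ <= X - _]mul1r -mulrBl ler_pM2r //.
have [w00|wN0] := eqVneq w 0; first by rewrite w00 powR0 ?gt_eqF //; lra.
have {}w0 : 0 < w by rewrite lt_neqAle eq_sym wN0.
have := powRN_ge w s w0 (ltW s0); rewrite powRN.
have := powR_gt0 s w0; move: (w `^ s) => q q0.
set d := s * (1 - w) => h.
have d01 : 0 <= d <= 1 by rewrite /d; nra.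
have hq : (1 + d) * q <= 1.
  by rewrite -ler_pdivlMr // div1r.
have -> : s / 2 * (1 - w) = d / 2 by rewrite /d; ring.
by nra.
Qed.

(** The absolute value keeps the base nonnegative, which makes the potential [Phi] below continuous
    on the whole space. *)
Lemma continuous_powR_norm s : 0 < s -> continuous (fun t : R => `|t| `^ s).
Proof.
move=> s0 t; have [->|tN0] := eqVneq t 0.
  apply/cvgrPdist_lt => e e0; near=> u.
  rewrite normr0 powR0 ?gt_eqF // sub0r normrN ger0_norm ?powR_ge0 //.
  have -> : e = (e `^ s^-1) `^ s by rewrite -powRrM mulVf ?gt_eqF // powRr1 ?ltW.
  apply: gt0_ltr_powR => //; rewrite ?nnegrE ?powR_ge0 //.
  near: u; have := @cvgr0_norm_lt _ R^o _ (nbhs (0:R)) _ id cvg_id (e `^ s^-1).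
  by apply; exact: powR_gt0.
apply: (@continuous_comp _ _ _ (fun t : R => `|t|) (fun t => t `^ s)).
  exact: norm_continuous.
apply/differentiable_continuous/derivable1_diffP/derivable_powR.
by rewrite in_itv /= andbT normr_gt0.
Unshelve. all: by end_near. Qed.

End Powers.

Section Growth.
Context {R : realType} {n : nat} {f : 'rV[R]_n -> \bar R} {pstar : R}.
Context {xstar : 'rV[R]_n}.
Implicit Types (x z : 'rV[R]_n) (u w : R).

Hypothesis f_ge0 : forall x, (0 <= f x)%E.
Hypothesis f_le : forall x, (f x <= pstar%:E)%E.
Hypothesis f_usc : usc f.
Hypothesis f_concave : concave f.
Hypothesis f_xstar : f xstar = pstar%:E.
Hypothesis pstar_gt0 : 0 < pstar.

(* Projecting the point [(z, f z + s)] onto the hypograph produces a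
   supergradient of [f] near [z], no longer than the local slope of [f] at [z]. *)
Lemma supergradient_near z (a K s : R) : f z = a%:E -> 0 < a -> 0 < s ->
  (forall z', norm2 (z' - z) <= s -> a <= fine (f z') ->
     fine (f z') - a <= K * norm2 (z' - z)) -> 0 <= K ->
  exists x zeta, [/\ norm2 (x - z) <= s, a <= fine (f x) <= a + s,
    proximal_supdiff f x zeta & norm2 zeta <= K].
Proof.
move=> fz a0 s0 slope K0.
have Hz : hypo f (z, a) by split => //=; rewrite fz.
have [[x u] cp pn] := hypo_projection f_concave _ f_xstar pstar_gt0 (z, a + s).
(* [d] is the vertical part of the normal. Testing the projection at [(z, a)] gives
   [N ^+ 2 <= d * (s - d)], which confines [d] and [N] to [[0, s]]. *)
pose d := a + s - u; pose N := norm2 (x - z).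
have N0 : 0 <= N by exact: norm2_ge0.
have N2 : N ^+ 2 <= d * (s - d).
  rewrite /N sqr_norm2; have := pn _ (subset_closure Hz).
  by rewrite /pdot /= !dotvE (dotvC z x) /d; lra.
have d0 : 0 <= d by nra.
have ds : d <= s by nra.
have u0 : 0 < u by rewrite /d in ds; lra.
have [Hp pnp] := projection_normal f_usc _ _ cp u0 pn.
have xz : N <= s by nra.
have uF : u <= fine (f x) by have [] := (hypoE f_ge0 f_le x u).1 Hp.
have dN0 : d != 0.
  apply/eqP => dE; move: N2; rewrite dE mul0r => N2.
  have : x - z = 0.
    by apply: dotvv_eq0; rewrite -sqr_norm2 -/N; apply/eqP; rewrite eq_le N2 sqr_ge0.
  move/eqP; rewrite subr_eq0 => /eqP E; move: uF; rewrite E fz /=.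
  by rewrite /d in dE; lra.
have {}d0 : 0 < d by rewrite lt_neqAle eq_sym dN0.
have Fu : fine (f x) = u.
  apply/eqP; rewrite eq_le uF andbT.
  have Hx : hypo f (x, fine (f x)).
    by apply/(hypoE f_ge0 f_le); split => //; exact: lt_le_trans uF.
  have := pn _ (subset_closure Hx).
  by rewrite /pdot /= subrr dotv0 add0r -/d pmulr_rle0 // subr_le0.
(* As [u - a = s - d], the slope bound turns [N ^+ 2 <= d * (s - d)] into [N ^+ 2 <= d * K * N]. *)
have NK : N <= d * K.
  have := slope x xz; rewrite Fu -/N => /(_ _).
  have -> : u = a + s - d by rewrite /d; ring.
  move=> /(_ ltac:(lra)) sl.
  have [->|NN] := eqVneq N 0; first by rewrite mulr_ge0 // ltW.
  have {}N0 : 0 < N by rewrite lt_neqAle eq_sym NN.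
  rewrite -(ler_pM2r N0) -expr2; apply: le_trans N2 _.
  by rewrite -mulrA ler_pM2l //; lra.
exists x, (d^-1 *: (x - z)); split => //.
- by rewrite Fu; rewrite /d in ds d0; lra.
- exists u; first by rewrite (fineK_f f_ge0 f_le) Fu.
  apply: proximal_normalW => // t Ht.
  have := pn _ (subset_closure Ht).
  rewrite -(pmulr_rle0 _ (_ : 0 < d^-1)) ?invr_gt0 //.
  congr (_ <= _); rewrite /pdot /= -/d !dotvE.
  by field.
by rewrite norm2Z gtr0_norm ?invr_gt0 // ler_pdivrMl.
Qed.

(* Ekeland's argument for the desingularised gap [(pstar - f) ^ (1 - theta)]:
   a minimiser of the gap plus a small multiple of the distance to [x] has slope
   too small for the Lojasiewicz inequality unless it maximises [f]. *)
Lemma growth_local xbar (theta : R) : 0 < theta < 1 -> f xbar = pstar%:E ->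
  lojasiewicz f theta xbar ->
  exists r kappa : R, [/\ 0 < r, 0 < kappa & forall x u, hypo f (x, u) ->
    norm2 (x - xbar) <= r -> exists2 z, f z = pstar%:E &
    norm2 (x - z) <= kappa * (pstar - u) `^ (1 - theta)].
Proof.
move=> /andP[t0 t1] fxbar [r [C [r0 C0 loj]]].
pose s := 1 - theta; have s01 : 0 < s <= 1 by rewrite /s; lra.
have /andP[s0 s1] := s01.
(* By [powRB_ge], slope [m] of the desingularised gap bounds the slope of [f] by [2 * m / s = C / 4]
   times the gap to the power [theta]: at most half of what the Lojasiewicz inequality demands at
   half the gap. *)
pose m := C * s / 8; have m0 : 0 < m by rewrite divr_gt0 ?mulr_gt0.
exists (r / 4), m^-1; split; rewrite ?divr_gt0 ?invr_gt0 // => x u Hxu xr.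
rewrite -/s; have u0 : 0 < u := hypo_gt0 _ Hxu.
have up : u <= pstar := hypo_le f_le _ Hxu.
(* A large gap lets [xbar] itself serve; a small one keeps the minimiser of [Phi] within [r / 2] of
   [x], away from the boundary of the ball. *)
have [big|small] := leP (m * r / 2) ((pstar - u) `^ s).
  by exists xbar => //; rewrite ler_pdivlMl //; nra.
pose Phi (p : 'rV[R]_n * R) : R := `|pstar - p.2| `^ s + m * norm2 (p.1 - x).
(* Heights at least [u > 0] keep these limit points inside the hypograph. *)
pose K := closure (hypo f) `&` [set p | - p.2 <= - u] `&`
  [set p | norm2 (p.1 - xbar) <= r].
have KH p : K p -> [/\ hypo f p, u <= p.2 & norm2 (p.1 - xbar) <= r].
  move=> [[cp /=]]; rewrite lerN2 => up2 pr; split => //.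
  by apply: hypo_closure => //; exact: lt_le_trans up2.
have HK p : hypo f p -> u <= p.2 -> norm2 (p.1 - xbar) <= r -> K p.
  move=> Hp up2 pr; split => //; split; first exact: subset_closure.
  by rewrite /= lerN2.
have c1 (y : 'rV[R]_n) : continuous (fun p : 'rV[R]_n * R => norm2 (p.1 - y)).
  apply: continuous_norm2 => p.
  by apply: cvgB; [exact: cvg_fst|exact: cvg_cst].
have cK : compact K.
  apply: (@bounded_closed_compact_pair _ _ _ (r + norm2 xbar + pstar)).
    apply: closedI; last exact: closed_le_continuous.
    apply: closedI; first exact: closed_closure.
    by apply: closed_le_continuous => p; apply: (@cvgN _ R^o); exact: cvg_snd.
  move=> p /KH[Hp _ pr]; have p0 := hypo_gt0 _ Hp.
  have pp := hypo_le f_le _ Hp.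
  have := norm2_triangle (p.1 - xbar) xbar; rewrite subrK => tr.
  by rewrite gtr0_norm //; have := norm2_ge0 xbar; split; lra.
have cPhi : continuous Phi.
  move=> p; apply: (@cvgD _ R^o).
    apply: (@continuous_comp _ _ _ (fun p : 'rV[R]_n * R => pstar - p.2)
      (fun t : R => `|t| `^ s)); last exact: continuous_powR_norm.
    by apply: (@cvgB _ R^o); [exact: cvg_cst|exact: cvg_snd].
  by apply: cvgM; [exact: cvg_cst|exact: c1].
have Kx : K (x, u) by apply: HK => //=; lra.
have [|| [z w]] := @compact_EVT_min _ R Phi K _ cK; first by exists (x, u).
  exact: continuous_subspaceT.
rewrite inE => /KH[Hzw /= uw zr] min.
have {}min p : K p -> Phi (z, w) <= Phi p by move=> Kp; apply: min; rewrite inE.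
have PhiE p : hypo f p ->
    Phi p = (pstar - p.2) `^ s + m * norm2 (p.1 - x).
  by move=> /(hypo_le f_le) pp; rewrite /Phi ger0_norm // subr_ge0.
have wp : w <= pstar := hypo_le f_le _ Hzw.
have w0 : 0 < w := hypo_gt0 _ Hzw.
have zx : m * norm2 (z - x) <= (pstar - u) `^ s - (pstar - w) `^ s.
  have := min _ Kx; rewrite !PhiE //= subrr norm2_0 mulr0 addr0; lra.
have p0 := powR_ge0 (pstar - w) s.
have [a fza] : exists a, f z = a%:E.
  by exists (fine (f z)); exact: (fineK_f f_ge0 f_le).
have wa : w <= a by have [_] := (hypoE f_ge0 f_le z w).1 Hzw; rewrite fza.
have ap : a <= pstar by rewrite -lee_fin -fza.
have [aE|aN] := eqVneq a pstar.
  exists z; first by rewrite fza aE.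
  by rewrite norm2B ler_pdivlMl //; lra.
have {}ap : a < pstar by rewrite lt_neqAle aN.
exfalso.
have Ka y b : hypo f (y, b) -> norm2 (y - xbar) <= r -> u <= b -> K (y, b).
  by move=> *; exact: HK.
have Hza : hypo f (z, a) by split => //=; rewrite ?fza //; exact: lt_le_trans wa.
have {}wa : w = a.
  apply/eqP; rewrite eq_le wa /= leNgt; apply/negP => lt_wa.
  have := min _ (Ka _ _ Hza zr (le_trans uw wa)); rewrite !PhiE //= lerD2r leNgt.
  by move=> /negP; apply; apply: gt0_ltr_powR => //; rewrite ?nnegrE; lra.
rewrite wa in zx uw min p0 PhiE.
pose G := pstar - a; have G0 : 0 < G by rewrite /G; lra.
have Gt0 : 0 < G `^ theta by exact: powR_gt0.
have zr' : norm2 (z - xbar) <= 3 / 4 * r.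
  have h1 : norm2 (z - x) <= r / 2 by rewrite -(ler_pM2l m0); lra.
  by have := norm2_triangle (z - x) (x - xbar); rewrite addrA subrK; lra.
(* Points within [e] of [z] stay in the ball of radius [r], and raising the value by [e] leaves at
   least half of the gap. *)
pose e := Num.min (r / 4) (G / 2).
have e0 : 0 < e by rewrite lt_min !divr_gt0.
have er : e <= r / 4 by rewrite ge_min lexx.
have eG : e <= G / 2 by rewrite ge_min lexx orbT.
have a0 : 0 < a by rewrite -wa.
have [||y [zeta [ye /andP[ay yae] sd zK]]] :=
  @supergradient_near z a (C / 4 * G `^ theta) e fza a0 e0.
- move=> z' z'e az'.
  have [->|az'N] := eqVneq (fine (f z')) a.
    by rewrite subrr mulr_ge0 ?norm2_ge0 // mulr_ge0 ?powR_ge0 // divr_ge0 // ltW.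
  have {}az' : a < fine (f z') by rewrite lt_neqAle eq_sym az'N.
  have Hz' : hypo f (z', fine (f z')).
    by apply/(hypoE f_ge0 f_le); split => //; apply: lt_trans az'; rewrite -wa.
  have z'r : norm2 (z' - xbar) <= r.
    by have := norm2_triangle (z' - z) (z - xbar); rewrite addrA subrK; lra.
  have := min _ (Ka _ _ Hz' z'r (le_trans uw (ltW az'))).
  rewrite !PhiE //= => h.
  have tr : norm2 (z' - x) <= norm2 (z' - z) + norm2 (z - x).
    by have := norm2_triangle (z' - z) (z - x); rewrite addrA subrK.
  have drop : (pstar - a) `^ s - (pstar - fine (f z')) `^ s <= m * norm2 (z' - z).
    by nra.
  have := @powRB_ge _ (pstar - a) (pstar - fine (f z')) s s01.
  rewrite subr_ge0 (fine_f_le f_ge0 f_le) -/G.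
  rewrite (_ : s - 1 = - theta) ?powRN; last by rewrite /s; ring.
  rewrite (_ : G - _ = fine (f z') - a); last by rewrite /G; ring.
  move=> /(_ isT ltac:(rewrite /G; lra)) /le_trans/(_ drop).
  rewrite mulrAC ler_pdivrMr // /m => h2.
  have : s * (fine (f z') - a) <= s * (C / 4 * G `^ theta * norm2 (z' - z)) by lra.
  by rewrite ler_pM2l.
- by rewrite mulr_ge0 ?powR_ge0 // divr_ge0 // ltW.
have yr : norm2 (y - xbar) <= r.
  by have := norm2_triangle (y - z) (z - xbar); rewrite addrA subrK; lra.
have := loj _ yr; rewrite fxbar (fineK_f f_ge0 f_le y) -EFinB poweR_EFin -EFinM.
have : (dist0 (proximal_supdiff f y) <= (norm2 zeta)%:E)%E.
  by apply: ereal_inf_lbound; exists zeta.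
move=> d1 d2; have := le_trans d2 d1; rewrite lee_fin => d3.
have G2 : G / 2 <= pstar - fine (f y) by rewrite /G in eG *; lra.
have h3 : (G / 2) `^ theta <= (pstar - fine (f y)) `^ theta.
  by apply: ge0_ler_powR; rewrite ?nnegrE; lra.
have h4 : G `^ theta / 2 <= (G / 2) `^ theta.
  rewrite powRM ?invr_ge0 ?(ltW G0) // ler_pM2l //.
  by apply: ger1_powR; [rewrite invr_gt0 ltr0n /= invf_le1 ?ler1n|exact: ltW].
clear -C0 d3 zK h3 h4 Gt0; nra.
Qed.

(** Compactness of the ball, with the constant taken near infinity so that local constants combine.
    Near a maximiser [growth_local] applies; near any other point the hypograph stays below a level
    [w < pstar], so the gap is bounded below and [xstar] serves. *)
Lemma growth_bounded (theta M : R) : 0 < theta < 1 ->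
  (forall z, f z = pstar%:E -> lojasiewicz f theta z) ->
  exists2 kappa : R, 0 < kappa & forall x u, hypo f (x, u) -> norm2 x <= M ->
    exists2 z, f z = pstar%:E &
    norm2 (x - z) <= kappa * (pstar - u) `^ (1 - theta).
Proof.
move=> t01 loj; pose P kappa x := forall u, hypo f (x, u) ->
  exists2 z, f z = pstar%:E &
    norm2 (x - z) <= kappa * (pstar - u) `^ (1 - theta).
have cn (y : 'rV[R]_n) : continuous (fun x : 'rV[R]_n => norm2 (x - y)).
  apply: (@continuous_norm2 _ _ _ (fun x : 'rV[R]_n => x - y)) => x.
  exact: (@cvgB _ 'rV[R]_n _ (nbhs x) _ id (fun=> y) x y cvg_id (cvg_cst y)).
have near_ball (y : 'rV[R]_n) (r : R) : 0 < r ->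
    \forall x \near y, norm2 (x - y) < r.
  move=> r0; have : norm2 (x - y) @[x --> y] --> norm2 (y - y) := cn y y.
  rewrite subrr norm2_0 => /cvgr0_norm_lt /(_ _ r0).
  by apply: filterS => x; rewrite ger0_norm // norm2_ge0.
have cB : compact [set x : 'rV[R]_n | norm2 x <= M].
  apply: (@subclosed_compact _ _
    [set x : 'rV[R]_n | forall i, `[- M, M]%classic (x ord0 i)]).
  - have := @closed_le_continuous _ _ _ M (cn 0).
    suff -> : [set x : 'rV[R]_n | norm2 (x - 0) <= M] = [set x | norm2 x <= M] by [].
    by apply/funext => x /=; rewrite subr0.
  - apply: (@rV_compact _ _ (fun=> `[- M, M]%classic)) => i.
    exact: segment_compact.
  - move=> x /= xM i; rewrite in_itv /= -ler_norml.
    exact: le_trans (norm2_coord _ _) xM.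
have near_P y : norm2 y <= M -> \forall x \near y & kappa \near +oo, P kappa x.
  move=> yM; have [fy|fyN] := eqVneq (f y) pstar%:E.
    have [r [kappa [r0 k0 h]]] := growth_local _ _ t01 fy (loj _ fy).
    exists ([set x | norm2 (x - y) < r], [set k | kappa <= k]).
      by split => /=; [exact: near_ball|apply: nbhs_pinfty_ge; exact: num_real].
    move=> [x k] /= [xr kk] u Hxu; have [z fz zx] := h x u Hxu (ltW xr).
    exists z => //; apply: le_trans zx _.
    by rewrite ler_wpM2r // powR_ge0.
  have Fy : fine (f y) < pstar.
    by rewrite -lte_fin -(fineK_f f_ge0 f_le) lt_neqAle fyN f_le.
  have Fy0 : 0 <= fine (f y) by rewrite fine_ge0.
  pose w := (fine (f y) + pstar) / 2.
  have w0 : 0 < w by rewrite /w; lra.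
  have wp : 0 < pstar - w by rewrite /w; lra.
  have nw : \forall x \near y, ~ hypo f (x, w).
    have nC : (~` closure (hypo f)) (y, w).
      move=> /(hypo_closure _ f_usc) /(_ w0) /(hypoE f_ge0 f_le)[_].
      by rewrite /w; lra.
    have cp : continuous (fun x : 'rV[R]_n => (x, w)).
      by apply: (@continuous_pair _ _ _ id (fun=> w));
        [move=> x; exact: cvg_id|exact: cst_continuous].
    have oC : open (~` closure (hypo f)) by apply: closed_openC; exact: closed_closure.
    have nC' : nbhs y (fun x => (~` closure (hypo f)) (x, w)) :=
      cp y _ (open_nbhs_nbhs (conj oC nC)).
    by apply: filterS nC' => x nc Hx; apply: nc; exact: subset_closure.
  pose D := 1 + norm2 (y - xstar).
  have D0 : 0 < D by rewrite ltr_pwDl // norm2_ge0.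
  have q0 : 0 < (pstar - w) `^ (1 - theta) by exact: powR_gt0.
  exists ([set x | norm2 (x - y) < 1 /\ ~ hypo f (x, w)],
    [set k | D / (pstar - w) `^ (1 - theta) <= k]).
    split => /=; last by apply: nbhs_pinfty_ge; exact: num_real.
    by apply: filterI nw; exact: near_ball.
  move=> [x k] /= [[x1 nHx] kk] u Hxu; exists xstar => //.
  have uw : u < w.
    by rewrite ltNge; apply/negP => wu; apply: nHx; exact: hypo_down Hxu w0 wu.
  have := norm2_triangle (x - y) (y - xstar); rewrite addrA subrK => tr.
  apply: (@le_trans _ _ D); first by rewrite /D; lra.
  rewrite ler_pdivrMr // in kk; apply: (le_trans kk).
  have k0 : 0 < k.
    rewrite ltNge; apply/negP => k0; move: kk.
    by rewrite leNgt => /negP; apply; apply: le_lt_trans D0; rewrite mulr_le0_ge0 // ltW.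
  rewrite ler_pM2l //; apply: ge0_ler_powR; rewrite ?nnegrE; lra.
have /compact_near_coveringP/(_ _ _ P _) := cB.
move=> /(_ +oo _ near_P) /pinfty_ex_gt0[kappa k0 h].
by exists kappa => // x u Hxu xM; exact: h.
Qed.

End Growth.

(** * Rate of the Polyak step *)

(* With [A = (kappa * a `^ (1 - theta)) ^+ 2] and [sigma = theta / (1 - theta)],
   the potential [(D k + A) `^ (- sigma)] grows by a constant at each step and
   never exceeds [A `^ (- sigma)], which is of order [a `^ (- 2 * theta)]. *)
Lemma polyak_step_count (R : realType) (theta kappa rho : R) :
  0 < theta < 1 -> 0 < kappa -> 0 < rho ->
  exists2 K0 : R, 0 < K0 & forall (T : nat) (D delta : nat -> R) (a : R), 0 < a ->
    (forall k, 0 <= D k) ->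
    (forall k, (k < T)%N -> [/\ a < delta k,
      D k.+1 <= D k - (rho * delta k) ^+ 2 &
      D k <= (kappa * delta k `^ (1 - theta)) ^+ 2]) ->
    T%:R <= K0 / a `^ (2 * theta).
Proof.
move=> /andP[t0 t1] k0 r0; pose s := 1 - theta.
have s0 : 0 < s by rewrite /s; lra.
pose sigma := theta / s; have sg0 : 0 < sigma by rewrite divr_gt0.
have sE : s^-1 = 1 + sigma by rewrite /sigma /s; field; rewrite gt_eqF // /s; lra.
pose b := (2 * kappa ^+ 2) `^ s^-1.
have b0 : 0 < b by rewrite powR_gt0 // mulr_gt0 // exprn_gt0.
pose c := rho ^+ 2 / b; have c0 : 0 < c by rewrite divr_gt0 // exprn_gt0.
pose q := (kappa ^+ 2) `^ (- sigma).
have q0 : 0 < q by rewrite powR_gt0 // exprn_gt0.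
exists (q / (sigma * c)); first by rewrite divr_gt0 // mulr_gt0.
move=> T D delta a a0 D0 step; rewrite -/s in step.
(* Adding [A], the error bound at gap [a], keeps the base of the negative power positive and costs
   only a factor 2, because [a < delta k]. *)
pose A := (kappa * a `^ s) ^+ 2.
have as0 : 0 < a `^ s by exact: powR_gt0.
have A0 : 0 < A by rewrite exprn_gt0 // mulr_gt0.
have t_gt0 k : 0 < D k + A by have := D0 k; lra.
have grow k : (k < T)%N ->
    (D k + A) `^ (- sigma) + sigma * c <= (D k.+1 + A) `^ (- sigma).
  move=> /step[ad Dk1 Dk]; have d0 : 0 < delta k by exact: lt_trans ad.
  set t := D k + A; set t' := D k.+1 + A.
  have tp : 0 < t := t_gt0 k; have t'p : 0 < t' := t_gt0 k.+1.
  have At : t <= 2 * kappa ^+ 2 * (delta k `^ s) ^+ 2.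
    have : a `^ s <= delta k `^ s.
      by apply: ge0_ler_powR; rewrite ?nnegrE; lra.
    rewrite /t /A => h; move: Dk; rewrite !exprMn => Dk.
    have h2 : (a `^ s) ^+ 2 <= (delta k `^ s) ^+ 2.
      by rewrite ler_sqr ?nnegrE // powR_ge0.
    have : 0 < kappa ^+ 2 by rewrite exprn_gt0.
    by nra.
  have tb : t `^ s^-1 <= b * delta k ^+ 2.
    have -> : b * delta k ^+ 2 = (2 * kappa ^+ 2 * (delta k `^ s) ^+ 2) `^ s^-1.
      rewrite [RHS]powRM ?sqr_ge0 ?mulr_ge0 ?sqr_ge0 ?(ltW k0) // -/b; congr (b * _).
      rewrite !expr2 powRM ?powR_ge0 // -powRrM mulfV ?gt_eqF //.
      by rewrite powRr1 ?(ltW d0).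
    by apply: ge0_ler_powR; rewrite ?nnegrE ?invr_ge0 ?(ltW s0) ?(ltW tp) //;
      apply: le_trans At; exact: ltW.
  (* The error bound read backwards: the decrease is at least [c] times [t] to the power
     [1 + sigma], as in a differential inequality for which the power [- sigma] grows linearly. *)
  have tt' : c * t `^ sigma * t <= t - t'.
    have -> : c * t `^ sigma * t = c * t `^ s^-1.
      rewrite sE powRD; last by rewrite (gt_eqF tp) implybT.
      by rewrite powRr1 ?(ltW tp) //; ring.
    apply: (@le_trans _ _ ((rho * delta k) ^+ 2)); last by rewrite /t /t'; lra.
    rewrite /c mulrAC ler_pdivrMr // exprMn -[X in _ <= X]mulrA ler_pM2l ?exprn_gt0 //.
    by rewrite mulrC.
  have wp : 0 < t' / t by rewrite divr_gt0.
  have := powRN_ge (t' / t) sigma wp (ltW sg0).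
  have -> : (t' / t) `^ (- sigma) = t' `^ (- sigma) * t `^ sigma.
    by rewrite powRM ?invr_ge0 ?(ltW tp) ?(ltW t'p) // -powR_inv1 ?(ltW tp) //
      -powRrM mulN1r opprK.
  rewrite (powRN t); have := powR_gt0 sigma tp; move: tt'.
  set p := t `^ sigma => tt' p0 h.
  have h2 : c * p <= 1 - t' / t.
    by rewrite -(ler_pM2r tp) mulrBl mul1r divfK // gt_eqF.
  rewrite -(ler_pM2r p0) mulrDl mulVf ?gt_eqF //.
  by apply: le_trans h; rewrite lerD2l -mulrA ler_pM2l.
have lin k : (k <= T)%N -> k%:R * (sigma * c) <= (D k + A) `^ (- sigma).
  elim: k => [_|k IH kT]; first by rewrite mul0r powR_ge0.
  have := grow _ kT; have := IH (ltnW kT).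
  by rewrite -natr1 mulrDl mul1r; lra.
rewrite mulrAC ler_pdivlMr ?(mulr_gt0 sg0 c0) //; apply: (le_trans (lin T (leqnn T))).
have AE : A `^ (- sigma) = q / a `^ (2 * theta).
  rewrite /A exprMn powRM ?sqr_ge0 // -/q -powRN; congr (_ * _).
  rewrite -powR_mulrn ?powR_ge0 // -!powRrM; congr (_ `^ _).
  by rewrite /sigma; field; rewrite gt_eqF.
rewrite -AE 2!powRN lef_pV2 ?posrE ?powR_gt0 //.
by apply: ge0_ler_powR; rewrite ?nnegrE ?(ltW sg0) ?(ltW A0) ?(ltW (t_gt0 _)) // lerDr.
Qed.

Section PolyakStep.
Context {R : realType} {n : nat}.

(** In the expanded square the cross term is at most [- 2 * al * delta] and the quadratic term
    equals [al * delta], [al] being the step; the net decrease is [(delta / norm2 zeta) ^+ 2]. *)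
Lemma polyak_dist (y z zeta : 'rV[R]_n) (delta rho : R) :
  0 < delta -> 0 < rho -> (zeta != 0 -> rho <= (norm2 zeta)^-1) ->
  dotv zeta (z - y) <= - delta ->
  dotv (y - (delta / norm2 zeta ^+ 2) *: zeta - z)
       (y - (delta / norm2 zeta ^+ 2) *: zeta - z) <=
  dotv (y - z) (y - z) - (rho * delta) ^+ 2.
Proof.
move=> d0 r0 rho_le sub.
have z0 : zeta != 0 by apply/eqP => E; move: sub; rewrite E dot0v; lra.
have N0 := norm2_gt0 _ z0; have {}rho_le := rho_le z0.
set al := delta / norm2 zeta ^+ 2.
have al0 : 0 < al by rewrite divr_gt0 // exprn_gt0.
have alE : al * dotv zeta zeta = delta by rewrite -sqr_norm2 divfK // gt_eqF // exprn_gt0.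
have alr : (rho * delta) ^+ 2 <= al * delta.
  have -> : al * delta = (delta / norm2 zeta) ^+ 2 by rewrite /al; field; rewrite gt_eqF.
  rewrite ler_sqr ?nnegrE ?mulr_ge0 ?invr_ge0 ?(ltW r0) ?(ltW d0) ?(ltW N0) //.
  by rewrite mulrC ler_pM2l.
have -> : y - al *: zeta - z = (y - z) - al *: zeta.
  by rewrite -!addrA; congr (_ + _); rewrite addrC.
move: sub; rewrite dotvDr dotvNr => sub.
rewrite (dotvDl (y - z)) !(dotvDr _ (y - z)) !(dotvNl, dotvNr, dotvZl, dotvZr).
have h : dotv (y - z) zeta = dotv zeta y - dotv zeta z.
  by rewrite dotvC dotvDr dotvNr.
rewrite (dotvC zeta (y - z)) h alE.
have : al * (dotv zeta z - dotv zeta y) <= al * - delta by rewrite ler_pM2l.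
by lra.
Qed.

End PolyakStep.

(** * The iteration bound *)

Theorem theorem3 (R : realType) (n : nat) (f : 'rV[R]_n -> \bar R)
    (pstar theta : R) (x0 : 'rV[R]_n)
    (f_ge0 : forall x, (0 <= f x)%E)
    (f_usc : usc f)
    (f_concave : concave f)
    (Rf_gt0 : (0 < Rconst f)%E)
    (pstar_sup : ereal_sup (range f) = pstar%:E)
    (pstar_gt0 : 0 < pstar)
    (pstar_attained : exists xstar, f xstar = pstar%:E)
    (theta01 : 0 < theta < 1)
    (f_loj : forall xstar, f xstar = pstar%:E -> lojasiewicz f theta xstar)
    (x0_dom : dom f x0) :
  exists2 K : R, 0 < K &
    forall (T : nat) (alpha : nat -> R) (y zeta : nat -> 'rV[R]_n),
      radial_subgradient_method f x0 T alpha y zeta ->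
      (forall k, (k < T)%N -> alpha k = polyak_stepsize f (y k) (zeta k)) ->
      forall eps : R, 0 < eps ->
        K / eps `^ (2 * theta) <= T%:R ->
        (\big[mine/+oo]_(k < T)
           ((pstar%:E - f (primal_iterate f (y k)))
              / f (primal_iterate f (y k))) <= eps%:E)%E.
Proof.
have [xs fxs] := pstar_attained.
have f_le x : (f x <= pstar%:E)%E.
  by rewrite -pstar_sup; apply: ereal_sup_ubound; exists x.
have [e e0 fe] :=
  hypo_zero f_le f_usc f_concave xs fxs pstar_gt0 Rf_gt0.
have [rho rho0 rhoR] : exists2 rho : R, 0 < rho & (rho%:E <= Rconst f)%E.
  move: Rf_gt0; case: (Rconst f) => [r| |] //; first by rewrite lte_fin; exists r.
  by move=> _; exists 1 => //; exact: leey.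
have /andP[t0 t1] := theta01.
pose g := radial_dual f; pose d := pstar^-1.
have d0 : 0 < d by rewrite invr_gt0.
have dp : d * pstar = 1 by rewrite mulVf // gt_eqF.
have infg : ereal_inf (range g) = d%:E :=
  inf_radial_dual f_le f_concave pstar_gt0 e0 fe _ fxs.
pose zs := d *: xs.
pose y0 := (Gamma (x0, fine (f x0))).1.
pose D0 := norm2 (y0 - zs); have D00 : 0 <= D0 by exact: norm2_ge0.
(* The iterates stay within [D0] of [zs] and the dual values are at least [d], so [M] bounds the
   primal iterates. *)
pose M := pstar * (D0 + norm2 zs).
have M0 : 0 <= M by rewrite mulr_ge0 ?(ltW pstar_gt0) // addr_ge0 // norm2_ge0.
have [kappa k0 growth] := growth_bounded f_ge0 f_le f_usc f_concave fxs pstar_gt0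
  theta M theta01 f_loj.
pose s := 1 - theta; have s0 : 0 < s by rewrite /s; lra.
(* The summands bound the two terms of [y k - d *: x = d *: (x_k - x) + delta k *: x_k], with [x_k]
   the primal iterate. *)
pose kappa1 := d * kappa * (pstar ^+ 2) `^ s + (D0 / rho) `^ theta * M.
have k1 : 0 < kappa1.
  rewrite ltr_pwDl //; last exact: mulr_ge0 (powR_ge0 _ _) M0.
  by rewrite !mulr_gt0 // powR_gt0 // exprn_gt0.
have [K0 K00 count] := polyak_step_count _ theta kappa1 rho theta01 k1 rho0.
(* The power of [pstar] converts the dual threshold [d * eps] into [eps]; the added 1 makes the
   final comparison strict. *)
pose K := K0 * pstar `^ (2 * theta) + 1.
exists K; first by rewrite ltr_wpDl // mulr_ge0 ?powR_ge0 // ltW.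
move=> T alpha y zeta [yE0 step] alphaE eps eps0 KT.
pose v k := fine (g (y k)); pose delta k := v k - d.
have gE k : (k < T)%N -> g (y k) = (v k)%:E.
  by move=> /step[[u gu _] _]; rewrite /v /g gu.
have vd k : (k < T)%N -> d <= v k.
  by move=> kT; rewrite -lee_fin -gE //; exact: (radial_dual_ge f_le pstar_gt0).
(* One iterate with dual gap at most [d * eps] suffices; otherwise the step count forces [T] below
   its assumed size. *)
have [k kT dk] : exists2 k, (k < T)%N & delta k <= d * eps.
  apply: contrapT => none.
  have big k : (k < T)%N -> d * eps < delta k.
    by move=> kT; rewrite ltNge; apply/negP => dk; apply: none; exists k.
  have de : 0 < d * eps by exact: mulr_gt0.
  have dpos k : (k < T)%N -> 0 < delta k by move=> /big; exact: lt_trans.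
  pose Y := [set z | f (pstar *: z) = pstar%:E].
  have Yzs : Y zs by rewrite /Y /= /zs scalerA mulrC dp scale1r.
  have sub k z : (k < T)%N -> Y z -> dotv (zeta k) (z - y k) <= - delta k.
    move=> kT Yz; have [sd _] := step k kT.
    have := subgradient_le f_le f_usc f_concave pstar_gt0 e0 fe _ _ _ (gE k kT) sd z d d0.
    rewrite /delta opprB; apply.
    by rewrite /d invrK; split => //=; rewrite Yz.
  have zrho k : (k < T)%N -> zeta k != 0 -> rho <= (norm2 (zeta k))^-1.
    move=> kT z0; rewrite -lee_fin; apply: (le_trans rhoR).
    have [sd _] := step k kT.
    exact: (subgradient_bound f_le f_usc f_concave pstar_gt0 e0 fe _ _ _ (gE k kT) sd).
  have next k z : (k < T)%N -> Y z ->
      dotv (y k.+1 - z) (y k.+1 - z) <=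
      dotv (y k - z) (y k - z) - (rho * delta k) ^+ 2.
    move=> kT Yz; have [_ ->] := step k kT.
    rewrite alphaE // /polyak_stepsize infg /= -/(v k) -/(delta k).
    exact: polyak_dist (dpos k kT) rho0 (zrho k kT) (sub k z kT Yz).
  have yD k : (k <= T)%N -> norm2 (y k - zs) <= D0.
    elim: k => [_|k IH kT]; first by rewrite yE0.
    apply: le_trans (IH (ltnW kT)); apply: ler_wsqrtr.
    by have := next k zs kT Yzs; have := sqr_ge0 (rho * delta k); lra.
  have near_opt k : (k < T)%N ->
      exists2 z, Y z & norm2 (y k - z) <= kappa1 * delta k `^ s.
    move=> kT; have dk := dpos k kT; have vk0 := lt_le_trans d0 (vd k kT).
    have yM : norm2 ((v k)^-1 *: y k) <= M.
      rewrite norm2Z gtr0_norm ?invr_gt0 // /M.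
      have := norm2_triangle (y k - zs) zs; rewrite subrK => tr.
      have {}tr : norm2 (y k) <= D0 + norm2 zs by have := yD k (ltnW kT); lra.
      have vp : (v k)^-1 <= pstar.
        by rewrite -[leRHS]invrK lef_pV2 ?posrE ?vd.
      have := norm2_ge0 (y k); have : 0 < (v k)^-1 by rewrite invr_gt0.
      by nra.
    have Hk := hypo_radial_dual f_usc _ _ vk0 (gE k kT).
    have [x fx xle] := growth _ _ Hk yM.
    exists (d *: x); first by rewrite /Y /= scalerA mulrC dp scale1r.
    have -> : y k - d *: x = d *: ((v k)^-1 *: y k - x) + delta k *: ((v k)^-1 *: y k).
      by apply/rowP => i; rewrite !mxE /delta; field; rewrite gt_eqF.
    apply: le_trans (norm2_triangle _ _) _.
    rewrite !(norm2Z d) !(norm2Z (delta k)) !gtr0_norm //.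
    have gap : (pstar - (v k)^-1) `^ s <= (pstar ^+ 2) `^ s * delta k `^ s.
      rewrite -powRM ?sqr_ge0 ?(ltW dk) //.
      have vp : (v k)^-1 <= pstar.
        by rewrite -[leRHS]invrK lef_pV2 ?posrE ?vd.
      apply: ge0_ler_powR; rewrite ?nnegrE ?(ltW s0) //; first by rewrite subr_ge0.
        by rewrite mulr_ge0 ?sqr_ge0 // ltW.
      have -> : pstar - (v k)^-1 = pstar * (v k)^-1 * delta k.
        by rewrite /delta /d; field; rewrite !gt_eqF.
      by rewrite ler_pM2r // expr2 ler_pM2l.
    (* Cauchy-Schwarz gives [delta k <= D0 / rho], so the factor [delta k] to the power [theta] is
       absorbed into a constant. *)
    have dlt : delta k <= (D0 / rho) `^ theta * delta k `^ s.
      have {1}-> : delta k = delta k `^ theta * delta k `^ s.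
        by rewrite -powRD ?(gt_eqF dk) ?implybT // /s addrC subrK powRr1 // ltW.
      rewrite ler_wpM2r ?powR_ge0 //; apply: ge0_ler_powR.
      + exact: ltW.
      + by rewrite nnegrE ltW.
      + by rewrite nnegrE divr_ge0 // ltW.
      have z0 : zeta k != 0.
        by apply/eqP => E; have := sub k zs kT Yzs; rewrite E dot0v; lra.
      have N0 := norm2_gt0 _ z0; have := zrho k kT z0.
      rewrite -(ler_pM2r N0) mulVf ?gt_eqF // => rN.
      rewrite ler_pdivlMr //.
      have := dotv_le (zeta k) (y k - zs); have := yD k (ltnW kT).
      have := sub k zs kT Yzs; rewrite !(dotvDr, dotvNr) => h1 h2 h3.
      have h4 : delta k <= norm2 (zeta k) * D0.
        by apply: (@le_trans _ _ (norm2 (zeta k) * norm2 (y k - zs)));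
          [lra|rewrite ler_pM2l].
      by nra.
    have m1 : d * norm2 ((v k)^-1 *: y k - x) <=
        d * kappa * (pstar ^+ 2) `^ s * delta k `^ s.
      rewrite -!mulrA ler_pM2l //; apply: (le_trans xle).
      by rewrite ler_pM2l.
    have m2 : delta k * norm2 ((v k)^-1 *: y k) <=
        (D0 / rho) `^ theta * M * delta k `^ s.
      rewrite [leRHS]mulrAC; apply: ler_pM => //; [exact: ltW|exact: norm2_ge0].
    by rewrite /kappa1 [leRHS]mulrDl; exact: lerD m1 m2.
  (* Infima replace nearest points: the decrease holds for each fixed [z] in [Y] and so passes to
     the infimum. *)
  pose dist2 k := [set dotv (y k - z) (y k - z) | z in Y].
  have lb k : lbound (dist2 k) 0 by move=> _ [z _ <-]; exact: dotvv_ge0.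
  have ne k : dist2 k !=set0 by exists (dotv (y k - zs) (y k - zs)); exists zs.
  have := count T (fun k => inf (dist2 k)) delta (d * eps) de.
  move=> /(_ (fun k => lb_le_inf (ne k) (lb k))).
  have : forall k, (k < T)%N -> [/\ d * eps < delta k,
      inf (dist2 k.+1) <= inf (dist2 k) - (rho * delta k) ^+ 2
      & inf (dist2 k) <= (kappa1 * delta k `^ (1 - theta)) ^+ 2].
    move=> k kT; split; first exact: big.
      rewrite lerBrDr; apply: lb_le_inf => // _ [z Yz <-].
      rewrite -lerBrDr; apply: le_trans (next k z kT Yz).
      by apply: ge_inf; [exists 0|exists z].
    have [z Yz yz] := near_opt k kT.
    apply: (@le_trans _ _ (dotv (y k - z) (y k - z))).
      by apply: ge_inf; [exists 0|exists z].
    rewrite -sqr_norm2 ler_sqr ?nnegrE ?norm2_ge0 //.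
    by rewrite mulr_ge0 ?powR_ge0 // ltW.
  move=> hyp bound; have := bound hyp; rewrite leNgt => /negP; apply.
  apply: lt_le_trans KT.
  have ep : 0 < eps `^ (2 * theta) by exact: powR_gt0.
  have dE : d `^ (2 * theta) = (pstar `^ (2 * theta))^-1.
    by rewrite /d -powR_inv1 ?(ltW pstar_gt0) // -powRrM mulN1r powRN.
  rewrite ltr_pdivlMr // powRM ?(ltW d0) ?(ltW eps0) // dE.
  have -> : K0 / ((pstar `^ (2 * theta))^-1 * eps `^ (2 * theta)) *
      eps `^ (2 * theta) = K0 * pstar `^ (2 * theta).
    by field; rewrite !gt_eqF // powR_gt0.
  by rewrite /K ltrDl.
apply: (@bigmin_inf _ _ _ _ (Ordinal kT)) => //=.
have vk0 := lt_le_trans d0 (vd k kT).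
have Hk := hypo_radial_dual f_usc _ _ vk0 (gE k kT).
rewrite /primal_iterate -/g -/(v k); set x := _ *: y k.
have [vi0 vF] := (hypoE f_ge0 f_le x _).1 Hk.
rewrite (fineK_f f_ge0 f_le x); set F := fine (f x) in vF *.
have F0 : 0 < F by exact: lt_le_trans vF.
rewrite inver (gt_eqF F0) -EFinB -EFinM lee_fin ler_pdivrMr //.
have Fv : 1 <= F * v k.
  by rewrite -(@mulVf _ (v k)) ?gt_eqF // ler_pM2r.
have h : pstar * delta k <= eps.
  by rewrite -(ler_pM2l d0) mulrA dp mul1r.
(* Here [pstar * d = 1], and the last summand is nonpositive because [F * v k >= 1]. *)
have -> : pstar - F = F * (pstar * delta k) + pstar * (1 - F * v k).
  by rewrite /delta mulrBr mulrBr mulrCA (mulrC pstar d) dp; ring.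
have : F * (pstar * delta k) <= F * eps by rewrite ler_pM2l.
have : pstar * (1 - F * v k) <= 0 by rewrite pmulr_rle0 // subr_le0.
by rewrite (mulrC eps); lra.
Qed.
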